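(* Let $p$ be a prime, let $f\in\mathbb{F}_p[X^{\pm1},Y^{\pm1}]$ be a non-zero Laurent polynomial, and let $c\in X_f$, i.e. $c\in\mathbb{F}_p[[X^{\pm1},Y^{\pm1}]]$ with $fc=0$. Suppose that $\mathrm{Ann}_{\mathbb{Z}}(c)$ contains a non-zero polynomial. Then: (1) If $f$ has no line polynomial factors, then $c$ is two-periodic. (2) If all line polynomial factors of $f$ are in the same direction $\mathbf{u}\in\mathbb{Z}^2\setminus\{\mathbf{0}\}$, then $c$ is periodic in this direction, i.e. $c$ has a non-zero vector of periodicity $\mathbf{t}\in\mathbb{Z}^2$ parallel to $\mathbf{u}$.
   Context: All polynomials are Laurent polynomials. For an integral domain $R$, $R[X^{\pm1},Y^{\pm1}]$ is the ring of Laurent polynomials and $R[[X^{\pm1},Y^{\pm1}]]$ is the set of formal two-sided power series $c=\sum_{(i,j)\in\mathbb{Z}^2}c_{i,j}X^iY^j$ (equivalently, functions $\mathbb{Z}^2\to R$), which is a module over $R[X^{\pm1},Y^{\pm1}]$ under the formal product. For a non-zero $f\in\mathbb{F}_p[X^{\pm1},Y^{\pm1}]$, the algebraic subshift defined by $f$ is $X_f=\{c\in\mathbb{F}_p[[X^{\pm1},Y^{\pm1}]] : fc=0\}$. A configuration $c\in\mathbb{F}_p[[X^{\pm1},Y^{\pm1}]]$ is also regarded as an element of $\mathbb{Z}[[X^{\pm1},Y^{\pm1}]]$ by replacing each coefficient in $\mathbb{F}_p$ by its representative in $\{0,1,\dots,p-1\}\subset\mathbb{Z}$; $\mathrm{Ann}_{\mathbb{Z}}(c)$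 is the set of $g\in\mathbb{Z}[X^{\pm1},Y^{\pm1}]$ with $gc=0$, the product being computed over $\mathbb{Z}$ for this integer configuration. For $f=\sum a_{i,j}X^iY^j$, $\mathrm{supp}(f)=\{(i,j): a_{i,j}\neq0\}$. A Laurent polynomial is a line polynomial in direction $\mathbf{u}\in\mathbb{Z}^2\setminus\{\mathbf{0}\}$ if its support contains at least two elements and is contained in $\{\mathbf{n}+r\mathbf{u} : r\in\mathbb{Q}\}$ for some $\mathbf{n}\in\mathbb{Z}^2$. Directions that are non-zero rational multiples of each other are the same. A line polynomial factor of $f$ is a line polynomial dividing $f$ in $\mathbb{F}_p[X^{\pm1},Y^{\pm1}]$. A vector of periodicity of $c$ is a non-zero $\mathbf{t}\in\mathbb{Z}^2$ such that $c_{\mathbf{n}-\mathbf{t}}=c_{\mathbf{n}}$ for all $\mathbf{n}\in\mathbb{Z}^2$; $c$ is two-periodic if it has two linearly independent vectors of periodicity. *)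

(* Defs.v *)
From mathcomp Require Import all_boot all_order all_algebra.
From mathcomp Require Import finmap.
From mathcomp.multinomials Require Import monalg.

Set Implicit Arguments.
Unset Strict Implicit.
Unset Printing Implicit Defensive.

Import GRing.Theory.
Local Open Scope fset_scope.
Local Open Scope ring_scope.

Notation Z2 := (int * int)%type.

(* [{malg R[K]}] is only used here as the group of finitely supported functions
   [K -> R]: its library product requires the monoid [K] to have no nontrivial
   units, so the product on [Z2]-indexed Laurent polynomials is [laurent_mul]. *)
Notation laurent R := {malg R[Z2]}.

Notation config R := (Z2 -> R).

Definition laurent_mul (R : idomainType) (g h : laurent R) : laurent R :=
  \sum_(a <- msupp g) \sum_(b <- msupp h) << g@_a * h@_b *g a + b >>.

Definition laurent_act (R : idomainType) (g : laurent R) (c : config R) :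
  config R := fun n => \sum_(m <- msupp g) g@_m * c (n - m).

Lemma laurent_mul_act (R : idomainType) (g h : laurent R) (n : Z2) :
  (laurent_mul g h)@_n = laurent_act g (fun m => h@_m) n.
Proof.
rewrite /laurent_mul /laurent_act raddf_sum /=; apply: eq_bigr => a _.
rewrite raddf_sum /=; under eq_bigr do rewrite mcoeffU.
have [hn|hn] := boolP (n - a \in msupp h).
  rewrite (big_fsetD1 (n - a)) //= [a + _]addrC subrK eqxx mulr1n.
  rewrite big_seq big1 ?addr0 // => b; rewrite in_fsetD1 => /andP[/eqP bn _].
  by case: eqP => // e; case: bn; rewrite -e addrC addKr.
rewrite (mcoeff_outdom hn) mulr0 big_seq big1 // => b hb.
by case: eqP => // e; rewrite -e addrC addKr hb in hn.
Qed.

Definition annihilates (R : idomainType) (g : laurent R) (c : config R) : Prop :=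
  forall n, laurent_act g c n = 0.

Definition subshift (p : nat) (f : laurent 'F_p) (c : config 'F_p) : Prop :=
  annihilates f c.

(* For [p] prime, [nat_of_ord] maps ['F_p] onto the representatives
   0, ..., p - 1. *)
Definition int_config (p : nat) (c : config 'F_p) : config int :=
  fun n => (nat_of_ord (c n))%:Z.

Definition AnnZ (p : nat) (c : config 'F_p) (g : laurent int) : Prop :=
  annihilates g (int_config c).

Definition laurent_dvd (R : idomainType) (g f : laurent R) : Prop :=
  exists h : laurent R, f = laurent_mul g h.

Definition rat_multiple (u v : Z2) : Prop :=
  exists r : rat, v.1%:~R = r * u.1%:~R /\ v.2%:~R = r * u.2%:~R.

Definition line_poly_in_dir (R : idomainType) (u : Z2) (g : laurent R) : Prop :=
  [/\ u != 0, (2 <= #|` msupp g|)%N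
    & exists n : Z2, forall m, m \in msupp g -> rat_multiple u (m - n)].

Definition line_poly (R : idomainType) (g : laurent R) : Prop :=
  exists u : Z2, line_poly_in_dir u g.

Definition line_factor (R : idomainType) (f g : laurent R) : Prop :=
  line_poly g /\ laurent_dvd g f.

Definition period (T : Type) (c : Z2 -> T) (t : Z2) : Prop :=
  t != 0 /\ forall n, c (n - t) = c n.

Definition lin_indep (s t : Z2) : Prop :=
  forall a b : int, s *~ a + t *~ b = 0 -> a = 0 /\ b = 0.

Definition two_periodic (T : Type) (c : Z2 -> T) : Prop :=
  exists s t : Z2, [/\ period c s, period c t & lin_indep s t].

Definition periodic_in_dir (T : Type) (u : Z2) (c : Z2 -> T) : Prop :=
  exists t : Z2, period c t /\ rat_multiple u t.

(* Main.v *)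
Require Import Defs.
From Stdlib Require Import FunctionalExtensionality.
From mathcomp Require Import all_boot all_order all_algebra.
From mathcomp Require Import finmap finfield.
From mathcomp.multinomials Require Import monalg.
From mathcomp Require Import zify ring.

(** Let [T^v] be the shift by [v].  If [g c = 0] over [int], then
    [g(T^q) c = g(T)^q c = 0] modulo every prime [q], hence exactly once [q]
    exceeds a bound on the coefficients of [g(T^q) c].  So [g(T^(1 + i r)) c = 0]
    for all [i] and some [r > 0], and Vandermonde elimination of the terms of [g]
    shows that a product of differences [T^w - 1] kills [c].

    Modulo [p] these differences are removed one by one.  In characteristic [p],
    a configuration [c] is periodic along [u] as soon as [(T^(N u) - 1) c] is, so
    it suffices to treat some [d] killed by [f] and by a single [T^w - 1].  If [w]
    is not parallel to [u], choose a basis [(v, w)] of [Z2] (with [w] primitive)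
    and write [f] as a polynomial in [T^v] with coefficients in [F_p[T^w]].  Let
    [P(T^w)] kill [d].  Splitting [P] along its gcds with the coefficients of [f],
    one may assume that each coefficient is zero or invertible modulo [P]; they
    are not all zero, since [f] has no line factor in direction [w].  Then [d] is
    determined by its values on a finite window, and the pigeonhole principle
    gives a period along [u]. *)

Set Implicit Arguments.
Unset Strict Implicit.
Unset Printing Implicit Defensive.

Import Order.TTheory GRing.Theory Num.Theory.
Local Open Scope fset_scope.
Local Open Scope ring_scope.

(** * Actions of polynomial rings on configurations *)

(** An [A]-module structure on configurations that commutes with all shifts. One interface serves
    scalars and polynomials in one or two shifts. *)
Record action (A R : comNzRingType) := Action {
  act :> A -> config R -> config R;
  actDl : forall a b c n, act (a + b) c n = act a c n + act b c n;
  actDr : forall a c d n, act a (fun m => c m + d m) n = act a c n + act a d n;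
  actM : forall a b c n, act (a * b) c n = act a (act b c) n;
  act1 : forall c n, act 1 c n = c n;
  act_shift : forall a c t n, act a (fun m => c (m - t)) n = act a c (n - t) }.

Section ActionTheory.
Variables (A R : comNzRingType) (rho : action A R).
Implicit Types (a b : A) (c d : config R) (n t : Z2).

Lemma eq_act a c d n : c =1 d -> rho a c n = rho a d n.
Proof. by move=> /functional_extensionality ->. Qed.

Lemma act0l c n : rho 0 c n = 0.
Proof. by apply: (addrI (rho 0 c n)); rewrite -actDl !addr0. Qed.

Lemma act0r a n : rho a (fun=> 0) n = 0.
Proof.
apply: (addrI (rho a (fun=> 0) n)); rewrite addr0 -actDr.
by apply: eq_act => m; rewrite addr0.
Qed.

Lemma act_eq0r a c n : c =1 (fun=> 0) -> rho a c n = 0.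
Proof. by move=> c0; rewrite (eq_act a n c0) act0r. Qed.

Lemma act_suml I (s : seq I) (F : I -> A) c n :
  rho (\sum_(i <- s) F i) c n = \sum_(i <- s) rho (F i) c n.
Proof. by elim/big_rec2: _ => [|i x y _ <-]; rewrite ?act0l ?actDl. Qed.

Lemma act_sumr I (s : seq I) a (F : I -> config R) n :
  rho a (fun m => \sum_(i <- s) F i m) n = \sum_(i <- s) rho a (F i) n.
Proof.
elim: s => [|i s IHs]; first by rewrite big_nil act_eq0r // => m; rewrite big_nil.
by rewrite big_cons -IHs -actDr; apply: eq_act => m; rewrite big_cons.
Qed.

Lemma act_diff a c t n :
  rho a (fun m => c (m - t) - c m) n = rho a c (n - t) - rho a c n.
Proof.
rewrite -(act_shift rho a c t n); apply: (addIr (rho a c n)).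
by rewrite subrK -actDr; apply: eq_act => m; rewrite subrK.
Qed.

Lemma actCA a b c n : rho a (rho b c) n = rho b (rho a c) n.
Proof. by rewrite -!actM mulrC. Qed.

Lemma act_killM a b c n : rho a c =1 (fun=> 0) -> rho (a * b) c n = 0.
Proof. by move=> c0; rewrite mulrC actM act_eq0r. Qed.

End ActionTheory.

Section Scalar.
Variable R : comNzRingType.

Definition scal_act (a : R) (c : config R) : config R := fun n => a * c n.

Definition scal_action : action R R.
Proof.
exists scal_act; rewrite /scal_act => *; rewrite ?mulrDl ?mulrDr ?mul1r ?mulrA //.
Defined.

End Scalar.

Section PolyAction.
Variables (A R : comNzRingType) (w : Z2) (rho : action A R).
Implicit Types (P Q : {poly A}) (c d : config R) (n t : Z2).

(** The variable acts as [T^w] and the coefficients through [rho], so the construction can be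
    iterated. *)
Definition poly_act P c : config R :=
  fun n => \sum_(i < size P) rho P`_i c (n - w *+ i).

Lemma poly_act_widen N P c n : (size P <= N)%N ->
  poly_act P c n = \sum_(i < N) rho P`_i c (n - w *+ i).
Proof.
move=> leN; rewrite /poly_act (big_ord_widen N (fun i => rho P`_i c (n - w *+ i))) //.
rewrite big_mkcond; apply: eq_bigr => i _; case: ltnP => // /(nth_default 0) ->.
by rewrite act0l.
Qed.

Lemma poly_actDl P Q c n : poly_act (P + Q) c n = poly_act P c n + poly_act Q c n.
Proof.
set N := maxn (size P) (size Q).
rewrite !(@poly_act_widen N) ?leq_maxl ?leq_maxr ?size_polyD //.
by rewrite -big_split; apply: eq_bigr => i _; rewrite coefD actDl.
Qed.

Lemma poly_actDr P c d n :
  poly_act P (fun m => c m + d m) n = poly_act P c n + poly_act P d n.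
Proof. by rewrite -big_split; apply: eq_bigr => i _; rewrite actDr. Qed.

Lemma poly_act_shift P c t n :
  poly_act P (fun m => c (m - t)) n = poly_act P c (n - t).
Proof. by apply: eq_bigr => i _; rewrite act_shift addrAC. Qed.

Lemma poly_actC a c n : poly_act a%:P c n = rho a c n.
Proof. by rewrite (poly_act_widen _ _ (size_polyC_leq1 a)) big_ord1 coefC subr0. Qed.

Lemma poly_actXr P c n : poly_act (P * 'X) c n = poly_act P c (n - w).
Proof.
have szP : (size (P * 'X)%R <= (size P).+1)%N.
  by rewrite (leq_trans (size_polyMleq _ _)) // size_polyX addn2.
rewrite (poly_act_widen _ _ szP) big_ord_recl coefMX act0l add0r.
by apply: eq_bigr => i _; rewrite coefMX /= mulrS opprD addrA.
Qed.

Lemma poly_actCM a Q c n : poly_act (a%:P * Q) c n = rho a (poly_act Q c) n.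
Proof.
have szQ : (size (a%:P * Q)%R <= size Q)%N.
  by rewrite mul_polyC size_scale_leq.
rewrite (poly_act_widen _ _ szQ) act_sumr; apply: eq_bigr => i _.
rewrite coefCM actM -act_shift; exact: eq_act.
Qed.

Lemma poly_actM P Q c n : poly_act (P * Q) c n = poly_act P (poly_act Q c) n.
Proof.
elim/poly_ind: P n => [|P a IHP] n.
  by rewrite mul0r /poly_act size_poly0 !big_ord0.
rewrite mulrDl !poly_actDl poly_actCM poly_actC poly_actXr -IHP.
by rewrite -mulrA [_ * Q]mulrC mulrA poly_actXr.
Qed.

Definition poly_action : action {poly A} R.
Proof.
exists poly_act.
- exact: poly_actDl.
- exact: poly_actDr.
- exact: poly_actM.
- by move=> c n; rewrite poly_actC act1.
- exact: poly_act_shift.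
Defined.

Lemma poly_actionXn P k c n : poly_action (P * 'X^k) c n = poly_action P c (n - w *+ k).
Proof.
elim: k n => [|k IHk] n; first by rewrite mulr1 subr0.
by rewrite exprSr mulrA /= poly_actXr [LHS]IHk mulrSr opprD addrA addrAC.
Qed.

End PolyAction.

(** The outer variable acts as [T^v], the inner one as [T^w]. *)
Definition biaction (R : comNzRingType) (v w : Z2) : action {poly {poly R}} R :=
  poly_action v (poly_action w (scal_action R)).

Section Monomials.
Variables (R : comNzRingType) (v w : Z2).

Definition bimon (i j : nat) (a : R) : {poly {poly R}} := (a%:P * 'X^j)%:P * 'X^i.

Lemma biaction_mon i j a c n :
  biaction R v w (bimon i j a) c n = a * c (n - v *+ i - w *+ j).
Proof. by rewrite /biaction poly_actionXn /= poly_actC [LHS]poly_actionXn /= poly_actC. Qed.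

Lemma bimonX i j a k : bimon i j a ^+ k = bimon (i * k) (j * k) (a ^+ k).
Proof. by rewrite /bimon exprMn -!exprM -rmorphXn exprMn -exprM -rmorphXn. Qed.

End Monomials.

(** * Annihilators over the integers *)

Lemma seq_int_bound (T : eqType) (s : seq T) (x : T -> int) :
  exists N : nat, forall m, m \in s -> 0 <= x m + N%:Z.
Proof.
elim: s => [|a s [N HN]]; first by exists 0%N.
exists (N + `|x a|)%N => m; rewrite inE => /orP[/eqP->|/HN]; lia.
Qed.

Lemma fst_mulrz (n : Z2) (k : int) : (n *~ k).1 = n.1 * k.
Proof. by rewrite (raddfMz fst) mulrzz. Qed.

Lemma snd_mulrz (n : Z2) (k : int) : (n *~ k).2 = n.2 * k.
Proof. by rewrite (raddfMz snd) mulrzz. Qed.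

Lemma Z2_eqP (m n : Z2) : m.1 = n.1 -> m.2 = n.2 -> m = n.
Proof. by case: m n => [? ?] [? ?] /= -> ->. Qed.

Lemma Z2_mulrn_eq0 (n : Z2) (k : nat) : (0 < k)%N -> (n *+ k == 0) = (n == 0).
Proof.
move=> k_gt0; apply/eqP/eqP => [nk0|->]; last exact: mul0rn.
have [n1 n2] : (n *+ k).1 = 0 /\ (n *+ k).2 = 0 by rewrite nk0.
rewrite (raddfMn fst) in n1; rewrite (raddfMn snd) in n2.
by apply: Z2_eqP; apply/eqP; [move/eqP: n1|move/eqP: n2];
  rewrite mulrn_eq0 (gtn_eqF k_gt0).
Qed.

Lemma Z2_decomp (n : Z2) : n = (1, 0) *~ n.1 + (0, 1) *~ n.2.
Proof. by apply: Z2_eqP; rewrite /= ?fst_mulrz ?snd_mulrz /=; ring. Qed.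

(** Up to a translation, the sum is a polynomial [F] in two shifts. Its [q]-th power has the
    exponents multiplied by [q] and the same coefficients, since these lie in ['F_q], and it kills
    whatever [F] kills. *)
Lemma frobenius_annihilates (q : nat) (s : seq Z2) (a : Z2 -> 'F_q)
    (e : Z2 -> Z2) (c : config 'F_q) : prime q ->
  (forall n, \sum_(v <- s) a v * c (n - e v) = 0) ->
  forall n, \sum_(v <- s) a v * c (n - e v *+ q) = 0.
Proof.
move=> q_pr ac0 n.
have [N1 HN1] := seq_int_bound s (fun v => (e v).1).
have [N2 HN2] := seq_int_bound s (fun v => (e v).2).
pose i v := `|((e v).1 + N1%:Z)%R|%N; pose j v := `|((e v).2 + N2%:Z)%R|%N.
pose N : Z2 := (1, 0) *+ N1 + (0, 1) *+ N2.
have eE v : v \in s -> (1, 0) *+ i v + (0, 1) *+ j v = e v + N :> Z2.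
  move=> vs; rewrite [e v]Z2_decomp !pmulrn /i /j.
  rewrite !gez0_abs ?HN1 ?HN2 // !mulrzDr addrACA //.
pose rho := biaction 'F_q (1, 0) (0, 1).
pose F := \sum_(v <- s) bimon (i v) (j v) (a v).
have F0 : rho F c =1 (fun=> 0).
  move=> m; rewrite act_suml -[RHS](ac0 (m - N)); apply: eq_big_seq => v vs.
  by rewrite biaction_mon -addrA -opprD eE // opprD addrA addrAC.
have q_char : q \in [pchar {poly {poly 'F_q}}].
  by rewrite !pchar_poly pchar_Fp.
have FE : F ^+ q = \sum_(v <- s) bimon (i v * q) (j v * q) (a v).
  have := rmorph_sum (pFrobenius_aut q_char) s xpredT (fun v => bimon (i v) (j v) (a v)).
  rewrite /= pFrobenius_autE => ->; apply: eq_bigr => v _.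
  rewrite pFrobenius_autE bimonX; congr bimon.
  by have := expf_card (a v); rewrite card_Fp.
(* The [q]-th power turns the translation [N] into [N *+ q], which the evaluation point undoes. *)
have := act_killM (F ^+ q.-1) (n + N *+ q) F0.
rewrite -exprS prednK ?prime_gt0 // FE act_suml => E; rewrite -[RHS]E.
apply: eq_big_seq => v vs; rewrite biaction_mon -addrA -opprD !mulrnA -mulrnDl eE //.
by rewrite [(e v + N) *+ q]mulrnDl opprD addrACA subrr addr0.
Qed.

Lemma int_Fp_eq0 (q : nat) (x : int) : prime q -> (`|x| < q)%N ->
  x%:~R = 0 :> 'F_q -> x = 0.
Proof.
move=> q_pr ltxq /eqP; rewrite -(dvdz_pcharf (pchar_Fp q_pr)) dvdzE /= => q_dvd.
by apply/eqP; rewrite -absz_eq0 -leqn0 leqNgt; apply/negP => /dvdn_leq/(_ q_dvd); lia.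
Qed.

Section IntegerConfig.
Variables (c : config int) (B : nat) (s : seq Z2) (a : Z2 -> int).
Hypothesis c_bound : forall n, (`|c n| <= B)%N.

(** This bound does not depend on where [c] is evaluated, so one threshold serves all successive
    dilations. *)
Let C := (\sum_(v <- s) `|a v| * B)%N.

Lemma absz_lincomb_le (e : Z2 -> Z2) : (`|(\sum_(v <- s) a v * c (e v))%R| <= C)%N.
Proof.
rewrite /C; elim/big_rec2: _ => // v x y _ le_xy.
have: (`|(a v * c (e v))%R| <= `|a v| * B)%N by rewrite abszM leq_mul2l c_bound orbT.
lia.
Qed.

Lemma prime_dilate (q : nat) (e : Z2 -> Z2) : prime q -> (C < q)%N ->
  (forall n, \sum_(v <- s) a v * c (n - e v) = 0) ->
  forall n, \sum_(v <- s) a v * c (n - e v *+ q) = 0.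
Proof.
move=> q_pr ltCq ac0 n.
apply: (int_Fp_eq0 q_pr); first exact: leq_ltn_trans (absz_lincomb_le _) ltCq.
have E e' : (\sum_(v <- s) a v * c (e' v))%:~R =
    \sum_(v <- s) (a v)%:~R * (c (e' v))%:~R :> 'F_q.
  by rewrite rmorph_sum /=; apply: eq_bigr => v _; rewrite rmorphM.
rewrite E; apply: (@frobenius_annihilates _ _ (fun v => (a v)%:~R) e
  (fun n => (c n)%:~R)) => // m.
by rewrite -(E (fun v => m - e v)) ac0.
Qed.

Lemma dilate (k : nat) : (0 < k)%N ->
  (forall q, prime q -> (q %| k)%N -> (C < q)%N) ->
  (forall n, \sum_(v <- s) a v * c (n - v) = 0) ->
  forall n, \sum_(v <- s) a v * c (n - v *+ k) = 0.
Proof.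
elim/ltn_ind: k => k IHk k_gt0 k_pr ac0 n.
have [k_le1|k_gt1] := leqP k 1.
  by have -> : k = 1%N by lia.
have [q q_pr q_dvd] : exists2 q, prime q & (q %| k)%N.
  by exists (pdiv k); rewrite ?pdiv_prime ?pdiv_dvd.
have q_gt1 := prime_gt1 q_pr.
have k'_gt0 : (0 < k %/ q)%N by rewrite divn_gt0 ?(ltnW q_gt1) // dvdn_leq.
have := @prime_dilate q (fun v => v *+ (k %/ q)) q_pr (k_pr _ q_pr q_dvd) _ n.
under eq_bigr do rewrite -mulrnA divnK //; apply=> m; apply: IHk => //.
  by rewrite ltn_Pdiv.
by move=> q' q'_pr q'_dvd; apply: k_pr => //; apply: dvdn_trans q'_dvd (dvdn_div q_dvd).
Qed.

Lemma dilate_progression : (forall n, \sum_(v <- s) a v * c (n - v) = 0) ->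
  exists2 r, (0 < r)%N &
    forall i n, \sum_(v <- s) a v * c (n - v *+ (i * r).+1) = 0.
Proof.
(* With [r] the factorial of [C], no prime up to [C] divides [1 + i * r]. *)
move=> ac0; exists C`! => [|i]; first exact: fact_gt0.
apply: dilate ac0 => // q q_pr q_dvd; rewrite ltnNge; apply/negP => leqC.
have : (q %| i * C`!)%N by rewrite dvdn_mull // dvdn_fact // prime_gt0.
move=> /dvdn_addr q_dvdD; move: q_dvd; rewrite -addn1 q_dvdD dvdn1.
by case: eqP q_pr => // ->.
Qed.

End IntegerConfig.

(** * Products of differences and elimination of terms *)

Section Differences.
Variable R : comNzRingType.
Implicit Types (c d : config R) (w : Z2) (ws : seq Z2).

Definition diff w c : config R := fun n => c (n - w) - c n.

Fixpoint diffs ws c : config R :=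
  if ws is w :: ws' then diffs ws' (diff w c) else c.

Lemma diffC w w' c : diff w (diff w' c) = diff w' (diff w c).
Proof.
apply: functional_extensionality => n; rewrite /diff.
by rewrite (addrAC n (- w)); ring.
Qed.

Lemma diffs_shift ws c t n : diffs ws (fun m => c (m - t)) n = diffs ws c (n - t).
Proof.
elim: ws c n => //= w ws IHws c n; rewrite -IHws /diff.
by congr diffs; apply: functional_extensionality => m; rewrite (addrAC m).
Qed.

Lemma diffsZ ws a c n : diffs ws (fun m => a * c m) n = a * diffs ws c n.
Proof.
elim: ws c n => //= w ws IHws c n; rewrite -IHws.
by congr diffs; apply: functional_extensionality => m; rewrite /diff mulrBr.
Qed.

(* Vandermonde elimination: a vanishing exponential sum whose [v]-th ratio is the
   shift by [r v] loses its [v1]-term under [T^(r v) - T^(r v1)]. *)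
Lemma eliminate (r : nat) (v0 : Z2) (s : seq Z2) (b : Z2 -> config R) :
    (0 < r)%N -> uniq (v0 :: s) ->
    (forall i n, \sum_(v <- v0 :: s) b v (n - v *+ (i * r)) = 0) ->
  exists2 ws, all (predC1 0) ws & forall n, diffs ws (b v0) n = 0.
Proof.
move=> r_gt0; elim: s b => [|v1 s IHs] b.
  by move=> _ /(_ 0%N) b0; exists [::] => // n; have := b0 n; rewrite big_seq1 subr0.
rewrite /= inE negb_or -andbA => /and4P[v01 v0s v1s us] b0.
pose b' v n := b v (n - v *+ r) - b v (n - v1 *+ r).
have [||ws ws0 bws] := IHs b'; first by rewrite /= v0s.
  move=> i n; rewrite sumrB.
  have shiftE v : n - v *+ (i * r) - v *+ r = n - v *+ (i.+1 * r).
    by rewrite mulSnr mulrnDr opprD addrA.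
  (* Adding the [v1]-term completes either sum to one that vanishes by hypothesis; the two added
     terms are equal and cancel. *)
  have E k m : b v1 (m - v1 *+ (k * r)) + \sum_(v <- v0 :: s) b v (m - v *+ (k * r)) = 0.
    by rewrite -[RHS](b0 k m) !big_cons addrCA.
  have E1 := E i.+1 n; have E2 := E i (n - v1 *+ r).
  under eq_bigr do rewrite shiftE.
  under [X in _ - X]eq_bigr do rewrite addrAC.
  move/(canRL (addKr _)): E1 => ->; move/(canRL (addKr _)): E2 => ->.
  by rewrite [n - v1 *+ r - _]addrAC shiftE subrr.
(* [T^(r v0) - T^(r v1)] is the shift [T^(r v1)] composed with the difference along [r (v0 - v1)], a
   nonzero vector. *)
exists (((v0 - v1) *+ r) :: ws) => [|n /=].
  rewrite /= ws0 andbT; by rewrite Z2_mulrn_eq0 // subr_eq0.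
have := bws (n + v1 *+ r).
have -> : b' v0 = (fun m => diff ((v0 - v1) *+ r) (b v0) (m - v1 *+ r)).
  apply: functional_extensionality => m; rewrite /b' /diff mulrnBl.
  by congr (b _ _ - _); rewrite opprB addrA subrK.
by rewrite diffs_shift addrK.
Qed.

End Differences.

Lemma diffs_rmorph (R S : comNzRingType) (h : {rmorphism R -> S}) ws (c : config R) n :
  diffs ws (fun m => h (c m)) n = h (diffs ws c n).
Proof.
elim: ws c n => //= w ws IHws c n; rewrite -IHws.
by congr diffs; apply: functional_extensionality => m; rewrite /diff rmorphB.
Qed.

Lemma laurent_neq0 (R : idomainType) (g : laurent R) :
  g != 0 -> exists v, v \in msupp g.
Proof.
move=> g0; case: (fset_0Vmem (msupp g)) => [gs0|[v vg]]; last by exists v.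
case/eqP: g0; apply/malgP => k; by rewrite mcoeff0 mcoeff_outdom ?gs0 ?in_fset0.
Qed.

Lemma AnnZ_diffs (p : nat) (c : config 'F_p) (g : laurent int) :
  prime p -> g != 0 -> AnnZ c g ->
  exists2 ws, all (predC1 0) ws & forall n, diffs ws c n = 0.
Proof.
move=> p_pr g0 gc0; pose x := int_config c.
have [v0 v0g] := laurent_neq0 g0.
have x_bound n : (`|x n| <= p)%N.
  by rewrite /x /int_config absz_nat ltnW // -[X in (_ < X)%N]Fp_cast.
set s := rem v0 (msupp g).
have gE : perm_eq (v0 :: s) (msupp g) by rewrite perm_sym perm_to_rem.
have us : uniq (v0 :: s) by rewrite (perm_uniq gE) fset_uniq.
pose a v := g@_v.
have E n : \sum_(v <- v0 :: s) a v * x (n - v) = 0.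
  by rewrite (perm_big _ gE) [LHS]gc0.
have [r r_gt0 Er] := dilate_progression x_bound E.
(* The [1] in [1 + i r] is absorbed into the terms, leaving shifts by [i r v]. *)
have [] := @eliminate _ r v0 s (fun v n => a v * x (n - v)) r_gt0 us.
  move=> i n; rewrite -[RHS](Er i n); apply: eq_bigr => v _; congr (_ * x _).
  by rewrite mulrS opprD addrA addrAC.
move=> ws ws0 wsx; exists ws => // n.
(* Over [int] the nonzero coefficient [g@_v0] cancels; reducing modulo [p] then gives back [c]. *)
have := wsx (n + v0); rewrite diffsZ (diffs_shift ws x) addrK => /eqP.
rewrite mulf_eq0 mcoeff_eq0 v0g /= => /eqP wsx0.
have -> : c = (fun m => intr (x m)).
  by apply: functional_extensionality => m; rewrite /x /int_config -pmulrn natr_Zp.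
by rewrite (diffs_rmorph intr) wsx0.
Qed.

(** * Periods along a direction *)

Definition periodic_along (R : Type) (u : Z2) (c : config R) : Prop :=
  exists2 N : nat, (0 < N)%N & forall n, c (n - u *+ N) = c n.

Lemma shift_mulrn (R : Type) (c : config R) (t : Z2) (k : nat) :
  (forall n, c (n - t) = c n) -> forall n, c (n - t *+ k) = c n.
Proof.
move=> ct; elim: k => [|k IHk] n; first by rewrite subr0.
by rewrite mulrS opprD addrA IHk.
Qed.

(* In characteristic [p], [(T^t - 1)^2 = 0] forces [T^(p t) = 1]. *)
Lemma periodic_along_diff (R : comNzRingType) (p : nat) (u : Z2) (c : config R)
    (N : nat) : p \in [pchar R] -> (0 < N)%N ->
  periodic_along u (diff (u *+ N) c) -> periodic_along u c.
Proof.
(* [t] is a multiple of the period [u *+ M] of the difference and also of its step [u *+ N]; this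
   makes [diff t c] periodic along [t]. *)
move=> p_char N_gt0 [M M_gt0 uM]; pose t := u *+ N *+ M.
have dN_t n : diff (u *+ N) c (n - t) = diff (u *+ N) c n.
  by rewrite /t mulrnAC; apply: shift_mulrn.
have dt_N n : diff t c (n - u *+ N) = diff t c n.
  have := dN_t n; rewrite /diff (addrAC n (- t)) => E.
  by rewrite -[c (n - u *+ N)](subrK (c n)) -E; ring.
have dt_t n : diff t c (n - t) = diff t c n by apply: shift_mulrn.
(* Along [t], the values of [c] form an arithmetic progression. *)
have ct k n : c (n - t *+ k) = c n + diff t c n *+ k.
  elim: k => [|k IHk] in n *; first by rewrite subr0 addr0.
  by rewrite mulrS opprD addrA IHk dt_t mulrS addrA /diff [c n + _]addrC subrK.
exists (N * M * p)%N => [|n]; first by rewrite !muln_gt0 N_gt0 M_gt0 prime_gt0 ?(pcharf_prime p_char).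
by rewrite !mulrnA -/t ct (mulrn_pchar p_char) addr0.
Qed.

Definition det2 (u w : Z2) : int := u.1 * w.2 - u.2 * w.1.

Lemma periodic_along_parallel (R : Type) (u w : Z2) (c : config R) : u != 0 -> w != 0 -> det2 u w = 0 ->
  (forall n, c (n - w) = c n) -> periodic_along u c.
Proof.
move=> u0 w0 uw0 cw.
have [a [b [a0 uaE]]] : exists a b : int, a != 0 /\ u *~ a = w *~ b.
  have [w10|w10] := eqVneq w.1 0; last first.
    exists w.1, u.1; split=> //; apply: Z2_eqP; rewrite ?fst_mulrz ?snd_mulrz.
      by rewrite mulrC.
    by move: uw0; rewrite /det2; lia.
  exists w.2, u.2; split; first by apply: contra_neq w0 => w20; apply: Z2_eqP.
  apply: Z2_eqP; rewrite ?fst_mulrz ?snd_mulrz; move: uw0; rewrite /det2; lia.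
have cwz (b' : int) n : c (n - w *~ b') = c n.
  case: b' => k; first exact: shift_mulrn.
  rewrite NegzE mulrNz opprK -pmulrn.
  by rewrite -[in LHS](shift_mulrn k.+1 cw) addrK.
exists `|a|%N => [|n]; first by rewrite absz_gt0.
rewrite pmulrn; have [|/ltW] := leP 0 a => a_ge0.
  by rewrite gez0_abs // uaE.
by rewrite lez0_abs // mulrNz uaE -mulrNz.
Qed.

(** * Laurent polynomials in a basis of the plane *)

Section LaurentAct.
Variable R : idomainType.
Implicit Types (g h : laurent R) (c : config R) (n m : Z2).

Lemma laurent_act_widen g (S : {fset Z2}) c n : msupp g `<=` S ->
  laurent_act g c n = \sum_(m <- S) g@_m * c (n - m).
Proof.
move=> gS; apply: big_fset_incl => // m _ mg.
by rewrite mcoeff_outdom // mul0r.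
Qed.

Lemma laurent_actD g h c n :
  laurent_act (g + h) c n = laurent_act g c n + laurent_act h c n.
Proof.
rewrite (laurent_act_widen c n (msuppD_le g h)).
rewrite (laurent_act_widen c n (fsubsetUl (msupp g) (msupp h))).
rewrite (laurent_act_widen c n (fsubsetUr (msupp g) (msupp h))).
by rewrite -big_split; apply: eq_bigr => m _; rewrite mcoeffD mulrDl.
Qed.

Lemma laurent_act0 c n : laurent_act 0 c n = 0.
Proof. by rewrite /laurent_act msupp0 big_seq_fset0. Qed.

Lemma laurent_act_suml I (s : seq I) (G : I -> laurent R) c n :
  laurent_act (\sum_(i <- s) G i) c n = \sum_(i <- s) laurent_act (G i) c n.
Proof.
by elim/big_rec2: _ => [|i x y _ <-]; rewrite ?laurent_act0 ?laurent_actD.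
Qed.

Lemma laurent_actU a m c n : laurent_act << a *g m >> c n = a * c (n - m).
Proof.
by rewrite (laurent_act_widen c n msuppU_le) big_seq_fset1 mcoeffUU.
Qed.

Lemma laurent_act_diff g c w n :
  laurent_act g (diff w c) n = diff w (laurent_act g c) n.
Proof.
by rewrite /laurent_act /diff -sumrB; apply: eq_bigr => m _; rewrite mulrBr (addrAC n).
Qed.

(** Acting on [delta] returns coefficients, so identities between actions become identities between
    Laurent polynomials. *)
Definition delta : config R := fun n => (n == 0)%:R.

Lemma laurent_act_delta g n : laurent_act g delta n = g@_n.
Proof.
have gS : msupp g `<=` n |` msupp g by exact: fsubsetUr.
rewrite (laurent_act_widen _ _ gS) (big_fsetD1 n) ?fset1U1 //=.
rewrite /delta subrr eqxx mulr1 big_seq big1 ?addr0 // => m.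
by rewrite in_fsetD1 => /andP[nm _]; rewrite subr_eq0 eq_sym (negPf nm) mulr0.
Qed.

Lemma laurent_of_bipoly v w (G : {poly {poly R}}) n0 :
  exists h : laurent R, forall c n, laurent_act h c n = biaction R v w G c (n + n0).
Proof.
exists (\sum_(i < size G) \sum_(j < size G`_i) << G`_i`_j *g v *+ i + w *+ j - n0 >>).
move=> c n; rewrite laurent_act_suml; apply: eq_bigr => i _.
rewrite laurent_act_suml; apply: eq_bigr => j _; rewrite laurent_actU.
by congr (_ * c _); move: (v *+ i) (w *+ j) => x y; apply: Z2_eqP => /=; ring.
Qed.

Section Basis.
Variables v w : Z2.
Hypothesis vw1 : det2 v w = 1.

Lemma Z2_basis n : n = v *~ det2 n w + w *~ det2 v n.
Proof.
apply: Z2_eqP; rewrite /= ?fst_mulrz ?snd_mulrz /det2.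
  by rewrite -[LHS]mulr1 -vw1 /det2; ring.
by rewrite -[LHS]mulr1 -vw1 /det2; ring.
Qed.

Lemma basis_neq0 : w != 0.
Proof. by apply: contra_eq_neq vw1 => ->; rewrite /det2 !mulr0. Qed.

(** In the basis [(v, w)], multiplying by one monomial clears the negative exponents; the monomial
    appears as the translation [n0]. *)
Lemma bipoly_of_laurent g : exists (G : {poly {poly R}}) n0,
  forall c n, laurent_act g c n = biaction R v w G c (n + n0).
Proof.
have [N1 HN1] := seq_int_bound (msupp g) (fun m => det2 m w).
have [N2 HN2] := seq_int_bound (msupp g) (fun m => det2 v m).
exists (\sum_(m <- msupp g)
  bimon `|(det2 m w + N1%:Z)%R|%N `|(det2 v m + N2%:Z)%R|%N g@_m).
exists (v *+ N1 + w *+ N2) => c n; rewrite act_suml; apply: eq_big_seq => m mg.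
rewrite biaction_mon; congr (_ * c _); rewrite {1}[m]Z2_basis.
move: (HN1 m mg) (HN2 m mg); move: (det2 m w) (det2 v m) => a b a_ge b_ge.
rewrite !pmulrn !gez0_abs // !mulrzDr.
by apply: Z2_eqP => /=; ring.
Qed.

(** The conditions on [P] put [0] and [w *+ (size P).-1] in the support of [P(T^w)], so it is not a
    mere monomial. The cofactor absorbs the translation [n0]. *)
Lemma line_factor_of_dvd f F n0 (P : {poly R}) :
    (forall c n, laurent_act f c n = biaction R v w F c (n + n0)) ->
    (1 < size P)%N -> P`_0 != 0 -> (exists G, F = P%:P * G) ->
  exists2 g, line_factor f g & line_poly_in_dir w g.
Proof.
move=> fF szP P0 [G FE].
have [g gP] := laurent_of_bipoly v w P%:P 0.
have [h hG] := laurent_of_bipoly v w G n0.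
have gE n : g@_n = \sum_(j < size P) P`_j * (n == w *+ j)%:R.
  rewrite -laurent_act_delta gP addr0 /= poly_actC.
  by apply: eq_bigr => j _; rewrite /= /scal_act /delta subr_eq0.
have w_inj : injective (fun j : nat => w *+ j).
  have w0 := basis_neq0.
  move=> i j /= ijE; wlog le_ij : i j ijE / (i <= j)%N => [W|].
    by case: (leqP i j) => [|/ltnW] /W; [apply|move=> H; apply/esym/H].
  move/eqP: ijE; rewrite eq_sym -subr_eq0 -mulrnBr //.
  by case: (posnP (j - i)) => [|k_gt0]; [lia|rewrite Z2_mulrn_eq0 // (negPf w0)].
have gwj (j : 'I_(size P)) : g@_(w *+ j) = P`_j.
  rewrite gE (bigD1 j) //= eqxx mulr1 big1 ?addr0 // => i ij.
  rewrite (inj_eq w_inj) ; case: eqP => [/val_inj ji|]; last by rewrite mulr0.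
  by rewrite ji eqxx in ij.
have g_dir : line_poly_in_dir w g.
  split; first exact: basis_neq0.
    have s0 : (0 < size P)%N by lia.
    have s1 : ((size P).-1 < size P)%N by lia.
    have g0 : 0 \in msupp g.
      by rewrite -mcoeff_neq0 -(mulr0n w) (gwj (Ordinal s0)).
    have g1 : w *+ (size P).-1 \in msupp g.
      rewrite -mcoeff_neq0 (gwj (Ordinal s1)) /= -lead_coefE lead_coef_eq0.
      by rewrite -size_poly_eq0; lia.
    have sub : [fset 0; w *+ (size P).-1] `<=` msupp g.
      by apply/fsubsetP => m; rewrite !inE => /orP[] /eqP->.
    apply: leq_trans (fsubset_leq_card sub); rewrite cardfs2.
    by rewrite eq_sym Z2_mulrn_eq0 ?basis_neq0 //; lia.
  exists 0 => m; rewrite subr0 -mcoeff_neq0 gE => gm.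
  have [j ->] : exists j, m = w *+ j.
    case: (pickP (fun j : 'I_(size P) => m == w *+ j)) => [j /eqP ->|no]; first by exists j.
    by move: gm; rewrite big1 ?eqxx // => j _; rewrite no mulr0.
  by exists j%:R; rewrite pmulrn fst_mulrz snd_mulrz !intrM !pmulrn ![_ * j%:~R]mulrC.
exists g => //; split; first by exists w.
exists h; apply/malgP => n; rewrite laurent_mul_act gP addr0.
rewrite -laurent_act_delta fF FE actM.
rewrite -[n0]opprK -act_shift; apply: eq_act => m.
by rewrite -laurent_act_delta hG opprK.
Qed.

End Basis.
End LaurentAct.

(** * Configurations determined by a finite window *)

(** A window of [K] consecutive positions slides one step either way. [van] will mean vanishing at a
    point, then vanishing on a whole line. *)
Lemma propagate (van : Z2 -> Prop) (v n0 : Z2) (K : nat) :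
    (forall n, (forall i, (i < K)%N -> van (n - v *+ i)) -> van (n - v *+ K)) ->
    (forall n, (forall i, (i < K)%N -> van (n - v *+ i)) -> van (n + v)) ->
    (forall i, (i < K)%N -> van (n0 - v *+ i)) ->
  forall k : int, van (n0 + v *~ k).
Proof.
move=> down up van0.
pose W n := forall i, (i < K)%N -> van (n - v *+ i).
have Wdown n : W n -> W (n - v).
  move=> Wn i ltiK; rewrite -addrA -opprD -mulrS.
  by have [/Wn//|] := ltnP i.+1 K => leKi; have -> : i.+1 = K; [lia|apply: down].
have Wup n : W n -> W (n + v).
  move=> Wn [|i] ltiK; first by rewrite subr0; apply: up.
  by rewrite mulrS opprD addrA addrK; apply/Wn/ltnW.
have Wall k : W (n0 + v *~ k).
  elim: k => [|k IHk|k IHk]; first by rewrite mulr0z addr0.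
    by rewrite -addn1 PoszD mulrzDr addrA; apply: Wup.
  by rewrite -addn1 PoszD opprD mulrzDr addrA; apply: Wdown.
(* For [K = 0] the window does not contain its base point, so the value comes from [up] one step
   earlier. *)
move=> k; have -> : n0 + v *~ k = n0 + v *~ (k - 1) + v.
  by rewrite mulrzBr -addrA subrK.
exact/up/Wall.
Qed.

Section Recurrence.
Variables (A R : comNzRingType) (w : Z2) (rho : action A R) (P : {poly A}).
Variable e : config R.
Hypothesis Pe0 : forall n, poly_action w rho P e n = 0.
Hypothesis P0 : P != 0.
Let K := (size P).-1.

(** [P(T^w) e = 0] is a linear recurrence of order [K] along [w]. Its coefficients act through
    [rho], so isolating [e] itself is left to invertibility of the extreme coefficient. *)
Lemma recurrence_last n : (forall i, (i < K)%N -> rho P`_i e (n - w *+ i) = 0) ->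
  rho (lead_coef P) e (n - w *+ K) = 0.
Proof.
move=> e0; have := Pe0 n; rewrite /= /poly_act.
have -> : size P = K.+1 by rewrite /K; move: P0; rewrite -size_poly_gt0; lia.
rewrite big_ord_recr big1 /= ?add0r // => i _; exact: e0.
Qed.

Lemma recurrence_first n :
  (forall i, (i < K)%N -> rho P`_i.+1 e (n - w *+ i) = 0) -> rho P`_0 e (n + w) = 0.
Proof.
move=> e0; have := Pe0 (n + w); rewrite /= /poly_act.
have -> : size P = K.+1 by rewrite /K; move: P0; rewrite -size_poly_gt0; lia.
rewrite big_ord_recl big1 ?addr0 /= ?subr0 // => i _.
by rewrite /bump add1n mulrS opprD addrA addrK e0.
Qed.

End Recurrence.

Section Window.
Variables (F : fieldType) (v w : Z2) (pi : {poly F}) (G : {poly {poly F}}).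
Hypothesis vw1 : det2 v w = 1.
Hypotheses (pi0 : pi`_0 != 0) (G0 : coprimep G`_0 pi).
Hypothesis lead_G : coprimep (lead_coef G) pi.

Let rho1 := poly_action w (scal_action F).

Lemma scal_act_eq0 (a : F) (e : config F) n :
  a != 0 -> scal_action F a e n = 0 -> e n = 0.
Proof. by move=> a0 /eqP; rewrite mulf_eq0 (negPf a0) => /eqP. Qed.

Lemma line_vanish (e : config F) n0 : (forall n, rho1 pi e n = 0) ->
    (forall j, (j < (size pi).-1)%N -> e (n0 - w *+ j) = 0) ->
  forall k : int, e (n0 + w *~ k) = 0.
Proof.
move=> pie0; have pin0 : pi != 0 by apply: contraNneq pi0 => ->; rewrite coef0.
apply: (@propagate (fun n => e n = 0)) => n e0.
  apply: (@scal_act_eq0 (lead_coef pi)); rewrite ?lead_coef_eq0 //.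
  by apply: recurrence_last => // i /e0; rewrite /= /scal_act => ->; rewrite mulr0.
apply: (@scal_act_eq0 pi`_0) => //.
by apply: (recurrence_first pie0) => // i /e0; rewrite /= /scal_act => ->; rewrite mulr0.
Qed.

(** By Bezout, [a] is invertible modulo [pi], and its inverse in [T^w] only involves values on the
    same line. *)
Lemma coprime_line_vanish (a : {poly F}) (e : config F) m :
    coprimep a pi -> (forall n, rho1 pi e n = 0) ->
    (forall k : int, rho1 a e (m + w *~ k) = 0) ->
  forall k : int, e (m + w *~ k) = 0.
Proof.
move=> /Bezout_eq1_coprimepP[[b b'] /= bE] pie0 ae0 k.
rewrite -(act1 rho1) -bE actDl !actM [X in _ + X]act_eq0r // addr0.
apply: big1 => j _; rewrite /= /scal_act.
have -> : m + w *~ k - w *+ j = m + w *~ (k - j%:Z) by rewrite mulrzBr addrA.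
by rewrite [X in _ * X]ae0 mulr0.
Qed.

Lemma window_vanish (e : config F) : (forall n, rho1 pi e n = 0) ->
    (forall n, biaction F v w G e n = 0) ->
    (forall i j, (i < (size G).-1)%N -> (j < (size pi).-1)%N ->
      e (- (v *+ i) - w *+ j) = 0) ->
  forall n, e n = 0.
Proof.
move=> pie0 Ge0 win0 n.
(* A nonzero constant [pi] kills only zero. This case is separate because [G] could then be [0],
   which is coprime to a unit. *)
have [pi1|pi1] := leqP (size pi) 1.
  rewrite -[n]addr0 -(mulr0z w); apply: line_vanish => // j.
  by rewrite ltnNge; case: leqP => // ? _; lia.
have Gn0 : G != 0.
  apply: contraTneq G0 => ->; rewrite coef0 coprimep_sym coprimep0 -size_poly_eq1.
  by rewrite gtn_eqF.
have rho1_0 a m (k : int) : (forall k : int, e (m + w *~ k) = 0) ->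
    rho1 a e (m + w *~ k) = 0.
  move=> e0; apply: big1 => j _; rewrite /= /scal_act.
  have -> : m + w *~ k - w *+ j = m + w *~ (k - j%:Z) by rewrite mulrzBr addrA.
  by rewrite e0 mulr0.
have shiftE x (k : int) i : x + w *~ k - v *+ i = x - v *+ i + w *~ k by rewrite addrAC.
rewrite [n](Z2_basis vw1) -[v *~ _]add0r; move: (det2 v n).
(* Whole lines parallel to [w] are propagated along [v]. *)
apply: (@propagate (fun m => forall k : int, e (m + w *~ k) = 0) v 0 (size G).-1).
- move=> m m0; apply: coprime_line_vanish lead_G pie0 _ => k.
  rewrite -shiftE; apply: (recurrence_last Ge0) => // i /m0 e0.
  by rewrite shiftE; apply: rho1_0.
- move=> m m0; apply: coprime_line_vanish G0 pie0 _ => k.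
  rewrite addrAC; apply: (recurrence_first Ge0) => // i /m0 e0.
  by rewrite shiftE; apply: rho1_0.
by move=> i ltiK; apply: line_vanish => // j ltj; rewrite add0r; apply: win0.
Qed.

End Window.

Section Pigeonhole.
Variables (F : finFieldType) (A : comNzRingType) (rho : action A F) (a b : A).
Variables (I : finType) (pos : I -> Z2) (u : Z2).
Hypothesis window : forall e : config F, (forall n, rho a e n = 0) ->
  (forall n, rho b e n = 0) -> (forall i, e (pos i) = 0) -> forall n, e n = 0.

(** Two of sufficiently many translates of [d] along [u] agree on the window; their difference is
    killed by [a] and [b], hence zero. *)
Lemma window_periodic (d : config F) : (forall n, rho a d n = 0) ->
  (forall n, rho b d n = 0) -> periodic_along u d.
Proof.
move=> ad0 bd0.
pose win (k : 'I_(#|{ffun I -> F}|.+1)) : {ffun I -> F} :=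
  [ffun i => d (pos i - u *+ k)].
have /injectivePn[k [l kl winE]] : ~~ injectiveb win.
  apply/negP => /injectiveP/leq_card; rewrite card_ord ltnn //.
wlog ltkl : k l kl winE / (k < l)%N => [W|].
  have [/W|lelk] := ltnP k l; first exact.
  by apply: (W l k); rewrite 1?eq_sym // ltn_neqAle lelk andbT eq_sym.
exists (l - k)%N => [|n]; first by rewrite subn_gt0.
pose e n := d (n - u *+ k - u *+ (l - k)) - d (n - u *+ k).
pose d' n := d (n - u *+ k).
have act_e x m : (forall n, rho x d n = 0) -> rho x e m = 0.
  move=> xd0; have -> : rho x e m = rho x (fun m => d' (m - u *+ (l - k)) - d' m) m.
    by apply: eq_act => m'; rewrite /e /d' addrAC.
  by rewrite act_diff /d' !act_shift !xd0 subrr.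
have e0 : forall n, e n = 0.
  apply: window => [m|m|i]; rewrite ?act_e // /e.
  rewrite -addrA -opprD -mulrnDr subnKC ?(ltnW ltkl) //.
  by move/ffunP/(_ i): winE; rewrite !ffunE => ->; rewrite subrr.
have := e0 (n + u *+ k); rewrite /e addrK => /eqP.
by rewrite subr_eq0 => /eqP.
Qed.

End Pigeonhole.

(** * Removing the differences *)

Lemma bipoly_dvdP (F : fieldType) (P : {poly F}) (G : {poly {poly F}}) :
  (forall i, P %| G`_i) -> exists H, G = P%:P * H.
Proof.
move=> PG; exists (\poly_(i < size G) (G`_i %/ P)); apply/polyP => i.
rewrite coefCM coef_poly; case: ltnP => [_|/(nth_default 0) ->]; last by rewrite mulr0.
by rewrite mulrC divpK.
Qed.

Section Core.
Variables (K : finFieldType) (p : nat) (p_char : p \in [pchar K]).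
Variables (v w u : Z2) (F : {poly {poly K}}).
Hypothesis vw1 : det2 v w = 1.
Hypothesis F_prim : forall P : {poly K}, (1 < size P)%N -> P`_0 != 0 ->
  ~ exists G, F = P%:P * G.

Let rho1 := poly_action w (scal_action K).
Let rho := biaction K v w.

Lemma biactionC (P : {poly K}) d n : rho P%:P d n = rho1 P d n.
Proof. by rewrite /rho /= poly_actC. Qed.

Lemma periodic_coprime_coefs (P : {poly K}) (d : config K) :
    (1 < size P)%N -> P`_0 != 0 ->
    (forall i, (P %| F`_i) || coprimep F`_i P) ->
    (forall n, rho1 P d n = 0) -> (forall n, rho F d n = 0) ->
  periodic_along u d.
Proof.
move=> szP P0 PF Pd Fd.
pose F' := \poly_(i < size F) (if P %| F`_i then 0 else F`_i).
have F'd n : rho F' d n = 0.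
  rewrite -[RHS](Fd n) /rho /= (poly_act_widen _ _ _ _ (size_poly _ _)).
  apply: eq_bigr => i _; rewrite coef_poly ltn_ord.
  case: ifP => // /dvdpP[q ->]; rewrite act0l mulrC.
  by apply/esym; apply: act_killM.
have F'cop i : F'`_i != 0 -> coprimep F'`_i P.
  rewrite coef_poly; case: ltnP => _; last by rewrite eqxx.
  by case: ifP => [|dv _]; [rewrite eqxx|have := PF i; rewrite dv].
have F'0 : F' != 0.
  apply/eqP => F'0; apply: (F_prim szP P0); apply: bipoly_dvdP => i.
  have := congr1 (fun Q : {poly _} => Q`_i) F'0; rewrite coef_poly coef0.
  case: ltnP => [_|leFi _]; last by rewrite nth_default ?dvdp0.
  by case: ifP => // + E; rewrite E dvdp0.
(* Removing the largest power of the outer variable, which acts as an invertible shift, makes the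
   constant coefficient nonzero. *)
have [k [G]] := multiplicity_XsubC F' 0.
rewrite F'0 subr0 /= => G0 F'E.
have Gcop i : G`_i != 0 -> coprimep G`_i P.
  by have := F'cop (i + k)%N; rewrite F'E coefMXn ltnNge leq_addl /= addnK.
have Gd n : rho G d n = 0.
  by have := F'd (n + v *+ k); rewrite F'E /rho poly_actionXn addrK.
have Gn0 : G != 0 by apply: contraNneq F'0 => Gn0; rewrite F'E Gn0 mul0r.
apply: (@window_periodic _ _ rho P%:P G
   ('I_(size G).-1 * 'I_(size P).-1)%type (fun ij => - (v *+ ij.1) - w *+ ij.2)) => //.
  move=> e Pe Ge e0; apply: (@window_vanish _ v w P G) => //.
  - by apply: Gcop; rewrite -horner_coef0.
  - by apply: Gcop; rewrite -lead_coefE lead_coef_eq0.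
  - by move=> n; rewrite -[LHS]biactionC.
  - by move=> i j lti ltj; apply: (e0 (Ordinal lti, Ordinal ltj)).
by move=> n; rewrite biactionC.
Qed.

(** Induction on the size of [P]: a coefficient neither divisible by [P] nor coprime to it yields a
    proper factorization [P = S * Q], with [S] killing [Q(T^w) d]. *)
Lemma periodic_of_line_annihilator (P : {poly K}) : P`_0 != 0 ->
  forall d, (forall n, rho1 P d n = 0) -> (forall n, rho F d n = 0) ->
  periodic_along u d.
Proof.
have [k] := ubnP (size P); elim: k => // k IHk in P * => ltPk P0 d Pd Fd.
have [szP|szP] := leqP (size P) 1.
  exists 1%N => // n; suff d0 m : d m = 0 by rewrite !d0.
  have := Pd m; rewrite [P]size1_polyC // /rho1 /= poly_actC => /eqP.
  by rewrite mulf_eq0 (negPf P0) => /eqP.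
have [allF|] := boolP (all (fun a => (P %| a) || coprimep a P) F).
  apply: (periodic_coprime_coefs szP P0 _ Pd Fd) => i.
  have [lti|leFi] := ltnP i (size F); last by rewrite nth_default ?dvdp0.
  by apply: (allP allF); apply: mem_nth.
case/allPn => a _; rewrite negb_or => /andP[ndvd ncop].
pose Q := gcdp a P; have QP : Q %| P := dvdp_gcdr _ _.
have PE := divpK QP; set S := P %/ Q in PE.
have Pn0 : P != 0 by rewrite -size_poly_gt0; lia.
have [S0 Q0] : S != 0 /\ Q != 0.
  by apply/andP; rewrite -negb_or -mulf_eq0 PE.
have Q1 : size Q != 1%N by [].
have QltP : (size Q < size P)%N.
  rewrite ltn_neqAle dvdp_leq // andbT; apply: contraNN ndvd.
  by rewrite dvdp_size_eqp // => /eqp_dvdl <-; apply: dvdp_gcdl.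
have szE : size P = (size S + size Q).-1 by rewrite -PE size_mul.
have Qgt0 : (0 < size Q)%N by rewrite size_poly_gt0.
have ltSk : (size S < k)%N.
  move: Q1 Qgt0 szE ltPk; move: (size P) (size S) (size Q) => x y z.
  by clear; lia.
have [Sc Qc] : S`_0 != 0 /\ Q`_0 != 0.
  by apply/andP; rewrite -negb_or -mulf_eq0 -coef0M PE.
have [||N N_gt0 dN] := IHk S ltSk Sc (rho1 Q d).
- by move=> n; rewrite -actM PE.
- move=> n; rewrite -(eq_act rho F n (biactionC Q d)) actCA.
  by rewrite act_eq0r.
(* Since [Q(T^w) d] has period [u *+ N], the difference of [d] along [u *+ N] is killed by the
   smaller polynomial [Q]. *)
apply: (periodic_along_diff p_char N_gt0); apply: (IHk Q) => //; first exact: leq_trans QltP ltPk.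
- by move=> n; rewrite /diff act_diff dN subrr.
- by move=> n; rewrite /diff act_diff !Fd subrr.
Qed.

End Core.

(** * Directions in the plane and the conclusion *)

Lemma rat_multiple_det (u z : Z2) : rat_multiple u z -> det2 z u = 0.
Proof.
case=> r [E1 E2]; apply: (@intr_inj rat); rewrite /det2 intrB !intrM E1 E2.
by rewrite mulrAC subrr.
Qed.

Lemma det2_eq0_trans (u w z : Z2) : z != 0 -> det2 z u = 0 -> det2 z w = 0 -> det2 u w = 0.
Proof.
move=> z0 zu zw; apply/eqP; apply: contraNT z0 => uw0.
have z1 : z.1 * det2 u w = u.1 * det2 z w - w.1 * det2 z u by rewrite /det2; ring.
have z2 : z.2 * det2 u w = u.2 * det2 z w - w.2 * det2 z u by rewrite /det2; ring.
move: z1 z2; rewrite zu zw !mulr0 subr0 => /eqP z1 /eqP z2.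
by apply/eqP/Z2_eqP; apply/eqP; [move: z1|move: z2]; rewrite mulf_eq0 (negPf uw0) orbF.
Qed.

(** The difference of two distinct support points is a nonzero vector parallel to both [u] and
    [w]. *)
Lemma line_poly_dir_unique (R : idomainType) (u w : Z2) (g : laurent R) :
  line_poly_in_dir u g -> line_poly_in_dir w g -> det2 u w = 0.
Proof.
have diff_dir t : line_poly_in_dir t g -> forall x y,
    x \in msupp g -> y \in msupp g -> det2 (x - y) t = 0.
  case=> _ _ [n gn] x y /gn/rat_multiple_det xn /gn/rat_multiple_det yn.
  by move: xn yn; rewrite /det2 /=; nia.
move=> gu gw; case: (gu) => _ card_g _.
have [x xg] : exists x, x \in msupp g.
  by case: (fset_0Vmem (msupp g)) card_g => [->|[x]]; [rewrite cardfs0|exists x].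
have [y] : exists y, y \in (msupp g `\ x).
  case: (fset_0Vmem (msupp g `\ x)) => [E|[y]]; last by exists y.
  by move: card_g; rewrite (cardfsD1 x) xg E cardfs0.
rewrite in_fsetD1 => /andP[yx yg].
apply: (@det2_eq0_trans _ _ (y - x)); rewrite ?subr_eq0 //; exact: diff_dir.
Qed.

Lemma primitive_decomp (w0 : Z2) : w0 != 0 ->
  exists v w (m : nat), [/\ det2 v w = 1, (0 < m)%N & w0 = w *+ m].
Proof.
move=> w00; have [a [b abE]] := Bezoutz w0.1 w0.2.
set m := gcdz w0.1 w0.2 in abE.
have m0 : m != 0.
  rewrite /m gcdz_eq0; apply: contra w00 => /andP[/eqP ? /eqP ?].
  by apply/eqP/Z2_eqP.
have [q1 E1] := dvdzP (dvdz_gcdl w0.1 w0.2).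
have [q2 E2] := dvdzP (dvdz_gcdr w0.1 w0.2).
have m_ge0 : 0 <= m by [].
rewrite -/m in E1 E2; clearbody m.
(* [m] is the gcd of the coordinates; dividing the Bezout relation by it gives determinant [1]. *)
exists (b, - a), (q1, q2), `|m|%N; split.
- by apply: (mulIf m0); rewrite mul1r -[RHS]abE E1 E2 /det2 /=; ring.
- by rewrite absz_gt0.
by apply: Z2_eqP; rewrite pmulrn ?fst_mulrz ?snd_mulrz /= gez0_abs.
Qed.

Lemma periodic_transverse (p : nat) (f : laurent 'F_p) (u w0 : Z2) (d : config 'F_p) :
    prime p -> w0 != 0 -> det2 u w0 != 0 ->
    (forall g, line_factor f g -> line_poly_in_dir u g) ->
    annihilates f d -> (forall n, d (n - w0) = d n) ->
  periodic_along u d.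
Proof.
move=> p_pr w00 uw0 f_dir fd dw0.
have [v [w [m [vw1 m_gt0 w0E]]]] := primitive_decomp w00.
have [F [n0 fF]] := bipoly_of_laurent vw1 f.
(* As [w0 = w *+ m], the period [w0] says that [(T^w)^m - 1] kills [d]. A line factor along [w]
   would also be along [u], against [uw0]. *)
apply: (@periodic_of_line_annihilator _ p (pchar_Fp p_pr) v w u F vw1 _ ('X^m - 1)).
- move=> P szP P0 PF; have [g gf gw] := line_factor_of_dvd vw1 fF szP P0 PF.
  have uw : det2 u w = 0 := line_poly_dir_unique (f_dir g gf) gw.
  case/eqP: uw0; rewrite w0E /det2 pmulrn fst_mulrz snd_mulrz.
  by move: uw; rewrite /det2; nia.
- by rewrite coefB coefXn coefC /= (ltn_eqF m_gt0) sub0r oppr_eq0 oner_eq0.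
- move=> n; have -> : 'X^m - 1 = 1 * 'X^m + (-1)%:P :> {poly 'F_p} by rewrite mul1r polyCN.
  by rewrite actDl poly_actionXn act1 /= poly_actC /= /scal_act mulN1r -w0E dw0 subrr.
by move=> n; rewrite -(subrK n0 n) -fF fd.
Qed.

Lemma periodic_along_of_diffs (p : nat) (f : laurent 'F_p) (u : Z2) ws (c : config 'F_p) :
    prime p -> u != 0 -> (forall g, line_factor f g -> line_poly_in_dir u g) ->
    annihilates f c -> all (predC1 0) ws -> (forall n, diffs ws c n = 0) ->
  periodic_along u c.
Proof.
move=> p_pr u0 f_dir; elim: ws c => [|w ws IHws] c fc.
  by move=> _ /= c0; exists 1%N => // n; rewrite !c0.
have f_diff t : annihilates f (diff t c).
  by move=> n; rewrite laurent_act_diff /diff !fc subrr.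
case/andP => w0 ws0 wsc; have [N N_gt0 dN] := IHws _ (f_diff w) ws0 wsc.
apply: (periodic_along_diff (pchar_Fp p_pr) N_gt0).
(* Differences commute, so the period [u *+ N] of [diff w c] becomes the period [w] of
   [diff (u *+ N) c]. *)
have dw n : diff (u *+ N) c (n - w) = diff (u *+ N) c n.
  apply/eqP; rewrite -subr_eq0 -/(diff w (diff (u *+ N) c) n) diffC.
  by rewrite /diff -/(diff w c _) -/(diff w c _) dN subrr.
have [uw0|uw0] := eqVneq (det2 u w) 0.
  exact: (periodic_along_parallel u0 w0 uw0 dw).
exact: (periodic_transverse p_pr w0 uw0 f_dir (f_diff _) dw).
Qed.

Theorem theorem8 (p : nat) (p_prime : prime p)
    (f : laurent 'F_p) (f_neq0 : f != 0)
    (c : config 'F_p) (cXf : subshift f c)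
    (annZ_c : exists g : laurent int, g != 0 /\ AnnZ c g) :
  ((forall g : laurent 'F_p, ~ line_factor f g) -> two_periodic c) /\
  (forall u : Z2, u != 0 ->
     (forall g : laurent 'F_p, line_factor f g -> line_poly_in_dir u g) ->
     periodic_in_dir u c).
Proof.
have [g [g0 gc]] := annZ_c; have [ws ws0 wsc] := AnnZ_diffs p_prime g0 gc.
have per u : u != 0 -> (forall g, line_factor f g -> line_poly_in_dir u g) ->
    exists2 N, (0 < N)%N & period c (u *+ N).
  move=> u0 f_dir.
  have [N N_gt0 cN] := periodic_along_of_diffs p_prime u0 f_dir cXf ws0 wsc.
  by exists N => //; split; rewrite ?Z2_mulrn_eq0.
split=> [no_line | u u0 f_dir].
  (* Without line factors the direction hypothesis is vacuous, so both coordinate directions are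
     available. *)
  have [||N N_gt0 cN] := per (1, 0); [by []|by move=> h /no_line|].
  have [||M M_gt0 cM] := per (0, 1); [by []|by move=> h /no_line|].
  exists ((1, 0) *+ N), ((0, 1) *+ M); split=> // a b ab0.
  have := congr1 fst ab0; have := congr1 snd ab0.
  rewrite /= !pmulrn !fst_mulrz !snd_mulrz /=; nia.
have [N _ cN] := per u u0 f_dir; exists (u *+ N); split=> //.
by exists N%:R; rewrite pmulrn fst_mulrz snd_mulrz !intrM !pmulrn ![_ * N%:~R]mulrC.
Qed.
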